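(* Let $X$ be a topological space. The following are equivalent: (1) $X$ satisfies $\mathsf{S}_1(\mathcal{O},\mathcal{O})$ and $\mathsf{U}_{\mathrm{fin}}(\mathcal{O},\mathrm{T}^* )$. (2) $X$ satisfies $\mathsf{S}_1(\Lambda,\gimel(\mathrm{T}^* ))$. (3) $X$ satisfies $\mathsf{S}_1(\Omega,\gimel(\mathrm{T}^* ))$. (4) ONE has no winning strategy in the game $\mathsf{G}_1(\Omega,\gimel(\mathrm{T}^* ))$. (5) $\Omega\to(\gimel(\mathrm{T}^* ))^2_2$ holds. (6) $\Omega\to(\gimel(\mathrm{T}^* ))^2_k$ holds for all positive integers $k$.
   Context: Convention: a cover of the topological space $X$ is always a countable collection $\mathcal{U}$ of open subsets of $X$ such that $\bigcup\mathcal{U}=X$ and $X\notin\mathcal{U}$. $\mathscr{A},\mathscr{B}$ denote families of such covers of the underlying space $X$. $\mathcal{O}$ is the family of all covers of $X$. $\mathcal{U}$ is a large cover if each $x\in X$ belongs to infinitely many $U\in\mathcal{U}$; $\Lambda$ is the family of all large covers of $X$. $\mathcal{U}$ is an $\omega$-cover if $X\notin\mathcal{U}$ and for each finite $F\subseteq X$ there is $U\in\mathcal{U}$ with $F\subseteq U$; $\Omega$ is the family of all $\omega$-covers of $X$. $[\mathbb{N}]^{\aleph_0}$ is the set of infinite subsets of $\mathbb{N}$. For $A,B\in[\mathbb{N}]^{\aleph_0}$, $A\subseteq^*B$ means that $A\setminus B$ is finite. A family $Y\subseteq[\mathbb{N}]^{\aleph_0}$ is linearly refinable if for each $y\in Y$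 there is an infinite subset $\hat y\subseteq y$ such that the family $\hat Y=\{\hat y:y\in Y\}$ is linearly ordered by $\subseteq^*$ (any two of its elements are $\subseteq^*$-comparable). A cover $\mathcal{U}=\{U_n:n\in\mathbb{N}\}$ of $X$ (bijectively enumerated) is a $\tau^*$-cover of $X$ if the family $\{\{n:x\in U_n\}:x\in X\}$ is (a subset of $[\mathbb{N}]^{\aleph_0}$ and) linearly refinable. $\mathrm{T}^*$ is the family of all $\tau^*$-covers of $X$. A cover $\mathcal{U}$ of $X$ is multifinite if there is a partition of $\mathcal{U}$ into infinitely many finite covers of $X$. $\gimel(\mathscr{A})$ is the family of all covers $\mathcal{U}$ of $X$ such that either $\mathcal{U}$ is multifinite, or there is a partition $\mathcal{P}$ of $\mathcal{U}$ into finite sets such that $\{\bigcup\mathcal{F}:\mathcal{F}\in\mathcal{P}\}\setminus\{X\}\in\mathscr{A}$. $\mathsf{U}_{\mathrm{fin}}(\mathscr{A},\mathscr{B})$: for each sequence $\{\mathcal{U}_n\}_{n\in\mathbb{N}}$ of elements of $\mathscr{A}$ which do not contain a finite subcover, there are finite (possibly empty) subsets $\mathcal{F}_n\subseteq\mathcal{U}_n$, $n\in\mathbb{N}$, such that $\{\bigcup\mathcal{F}_n:n\in\mathbb{N}\}\in\mathscr{B}$. $\mathsf{S}_1(\mathscr{A},\mathscr{B})$: for each sequence $\{\mathcal{U}_n\}_{n\in\mathbb{N}}$ of elements of $\mathscr{A}$ there are $U_n\in\mathcal{U}_n$, $n\in\mathbb{N}$, such that $\{U_n:n\in\mathbb{N}\}\in\mathscr{B}$.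 $\mathsf{G}_1(\mathscr{A},\mathscr{B})$ is the game of two players, ONE and TWO, with an inning for each natural number $n$: in the $n$th inning ONE chooses $\mathcal{U}_n\in\mathscr{A}$ and TWO answers with $U_n\in\mathcal{U}_n$. TWO wins if $\{U_n:n\in\mathbb{N}\}\in\mathscr{B}$; otherwise ONE wins. $[A]^n$ denotes the set of $n$-element subsets of $A$. For positive integers $n,k$, the ordinary partition relation $\mathscr{A}\to(\mathscr{B})^n_k$ means: for each $A\in\mathscr{A}$ and each $f:[A]^n\to\{1,\dots,k\}$ there is $B\subseteq A$ such that $B\in\mathscr{B}$ and $f|_{[B]^n}$ is constant.
   Formalization: X is assumed nonempty: for the empty space the only cover is the empty collection, so (1) and (2) fail since nothing can be selected, while there are no ω-covers and (3)–(6) hold vacuously. *)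

(* Defs.v *)
From mathcomp Require Import all_boot all_order.
From mathcomp Require Import classical_sets boolp functions cardinality.
From mathcomp Require Import topology.

Set Implicit Arguments.
Unset Strict Implicit.
Unset Printing Implicit Defensive.

Local Open Scope classical_set_scope.

Section Covers.
Context {X : topologicalType}.
Implicit Types (U : set (set X)) (A : set (set (set X))).

(* Covers are by convention countable (possibly finite), open, and do not
   contain the whole space as a member. *)
Definition is_cover U :=
  [/\ countable U, U `<=` open, \bigcup_(V in U) V = [set: X] & ~ U [set: X]].

Definition large_cover U :=
  is_cover U /\ forall x : X, infinite_set [set V | U V /\ V x].

Definition omega_cover U :=
  is_cover U /\
  forall F : set X, finite_set F -> exists2 V, U V & F `<=` V.

Definition almost_subset (a b : set nat) := finite_set (a `\` b).

(* [h y] is the refinement of [y]; infinitude of each [y] in [Y] is implied. *)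
Definition linearly_refinable (Y : set (set nat)) :=
  exists h : set nat -> set nat,
    (forall y, Y y -> infinite_set (h y) /\ h y `<=` y) /\
    (forall a b, (h @` Y) a -> (h @` Y) b ->
       almost_subset a b \/ almost_subset b a).

(* The property does not depend on the bijective enumeration [e]. *)
Definition taustar_cover U :=
  is_cover U /\
  exists e : nat -> set X,
    [/\ set_bij [set: nat] U e,
        forall x : X, infinite_set [set n | e n x] &
        linearly_refinable (range (fun x : X => [set n | e n x]))].

Definition multifinite U :=
  exists P : set (set (set X)),
    [/\ partition P id U, infinite_set P &
        forall F, P F -> finite_set F /\ is_cover F].

Definition gimel A : set (set (set X)) :=
  [set U | is_cover U /\
    (multifinite U \/
     exists P : set (set (set X)),
       [/\ partition P id U,
           forall F, P F -> finite_set F &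
           A ([set \bigcup_(V in F) V | F in P] `\ [set: X])])].

Definition Ufin (A B : set (set (set X))) :=
  forall U : nat -> set (set X),
    (forall n, A (U n)) ->
    (forall n, ~ exists F, [/\ F `<=` U n, finite_set F & is_cover F]) ->
    exists F : nat -> set (set X),
      (forall n, finite_set (F n) /\ F n `<=` U n) /\
      B (range (fun n => \bigcup_(V in F n) V)).

End Covers.

Definition OO (X : topologicalType) : set (set (set X)) := [set U | is_cover U].
Definition Lambda (X : topologicalType) : set (set (set X)) :=
  [set U | large_cover U].
Definition Omega (X : topologicalType) : set (set (set X)) :=
  [set U | omega_cover U].
Definition Tstar (X : topologicalType) : set (set (set X)) :=
  [set U | taustar_cover U].

Arguments OO : clear implicits.
Arguments Lambda : clear implicits.
Arguments Omega : clear implicits.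
Arguments Tstar : clear implicits.

Section Principles.
Context {T : Type}.
Implicit Types A B : set (set T).

Definition S1 A B :=
  forall U : nat -> set T, (forall n, A (U n)) ->
    exists V : nat -> T, (forall n, U n (V n)) /\ B (range V).

(* A strategy for ONE maps the finite sequence of TWO's previous answers to
   ONE's next move; it only has to make legal moves at positions that can be
   reached when ONE follows it. *)
Definition legal_position (sigma : seq T -> set T) (s : seq T) :=
  forall s1 v s2, s = s1 ++ v :: s2 -> sigma s1 v.

Definition ONE_winning_strategy_G1 A B (sigma : seq T -> set T) :=
  (forall s, legal_position sigma s -> A (sigma s)) /\
  (forall V : nat -> T,
     (forall n, sigma (mkseq V n) (V n)) -> ~ B (range V)).

Definition ONE_has_winning_strategy_G1 A B :=
  exists sigma, ONE_winning_strategy_G1 A B sigma.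

Definition nsubsets (n : nat) (a : set T) : set (set T) :=
  [set s | s `<=` a /\ (s #= `I_n)%card].

(* Colourings of [nsubsets n a] are given by total functions; for [0 < k] every
   colouring with colours in ['I_k] extends to such a function. *)
Definition partition_relation A B (n k : nat) :=
  forall a, A a -> forall f : set T -> 'I_k,
    exists b, [/\ b `<=` a, B b &
      exists c, forall s, nsubsets n b s -> f s = c].

End Principles.

(* Main.v *)
Require Import Defs.
From mathcomp Require Import all_boot all_order.
From mathcomp Require Import classical_sets boolp functions cardinality.
From mathcomp Require Import topology.
From mathcomp Require Import zify.

(** The six conditions are linked by two bridges.

    From the selection hypotheses to the game.  Under [Ufin (OO X) (Tstar X)]
    every large cover already belongs to [gimel (Tstar X)]
    ([Lambda_sub_gimel]): cut an enumeration of the cover into consecutive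
    finite intervals, so long that either all of them cover [X], or their
    unions swallow the finite unions provided by the selection principle and
    inherit a linear refinement from them.  So the only task left in the game
    is to produce a large cover, and this is possible against every strategy
    of ONE: TWO can beat any strategy as soon as [S1 (OO X) (OO X)] holds
    ([S1_no_winning_strategy], a version of Pawlikowski's theorem).  Omega
    covers are large, which gives the game for [Omega X]; a strategy for ONE
    that plays a given sequence of covers turns the absence of winning
    strategies into the principles [S1].

    The partition relation follows from the game by a strategy for ONE which
    stays inside an ultrafilter all of whose members are omega covers: such an
    ultrafilter selects a single colour which ONE can impose on all pairs of
    answers of TWO ([game_partition_relation]).

    Back from the weak conditions.  [S1 (Omega X) B] and the partition relation
    for pairs and two colours both yield [omega_selection B]: from a sequence of
    omega covers one obtains a member of [B] whose elements are shrunk elements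
    of distinct covers of the sequence.  Feeding finite unions of elements of
    given covers into this principle recovers [S1 (OO X) (OO X)]
    ([omega_selection_S1]) and, when [B] is [gimel (Tstar X)],
    [Ufin (OO X) (Tstar X)] ([omega_selection_Ufin]). *)

Set Implicit Arguments.
Unset Strict Implicit.
Unset Printing Implicit Defensive.

Local Open Scope classical_set_scope.

(** * Countable combinatorics *)

Lemma infinite_natP (A : set nat) :
  infinite_set A <-> forall N, exists2 n, N <= n & A n.
Proof.
split=> [infA N|ubA /finite_seqP[s As]].
  have [n [An Nn]] := infinite_setN0 (infinite_setD infA (finite_II N)).
  by exists n => //; rewrite leqNgt; apply/negP.
have [n lt_n] := ubA (\max_(i <- s) i).+1.
rewrite As => /= ns; have := @leq_bigmax_seq _ s xpredT id n ns isT.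
by move=> /(leq_trans lt_n); rewrite ltnn.
Qed.

Lemma infinite_image_in T U (f : T -> U) (S : set T) :
  {in S &, injective f} -> infinite_set S -> infinite_set (f @` S).
Proof. by move=> f_inj; rewrite (eq_finite_set (inj_card_eq f_inj)). Qed.

Lemma countable_enum T (A : set T) :
  countable A -> A !=set0 -> exists e : nat -> T, range e = A.
Proof.
move=> /pfcard_geP[->|[f] _]; first by case.
by exists f; rewrite image_eq.
Qed.

(** Recursion on the full history: the next value may depend on all earlier
    ones, as in a play of a game. *)
Lemma seq_recursion T (R : seq T -> T -> Prop) :
  (forall s, exists t, R s t) ->
  exists f : nat -> T, forall n, R (mkseq f n) (f n).
Proof.
move=> /choice[g Rg]; pose h n := iter n (fun s => rcons s (g s)) [::].
exists (g \o h) => n; suff -> : mkseq (g \o h) n = h n by exact: Rg.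
by elim: n => //= n IHn; rewrite mkseqS IHn.
Qed.

Lemma uniform_bound (T : eqType) (F : set T) (P : T -> nat -> Prop) :
  finite_set F -> (forall c k k', k <= k' -> P c k -> P c k') ->
  (forall c, F c -> exists k, P c k) -> exists k, forall c, F c -> P c k.
Proof.
move=> /finite_seqP[s ->] monoP; elim: s => [|d s IHs] exP; first by exists 0.
have [|k Pk] := IHs; first by move=> c cs; apply: exP; rewrite /= inE orbC [_ \in _]cs.
have [|l Pl] := exP d; first exact: mem_head.
exists (maxn k l) => c /=; rewrite inE => /predU1P[->|/Pk].
  by apply: monoP Pl; exact: leq_maxr.
by apply: monoP; exact: leq_maxl.
Qed.

(** * Rothberger's property for indexed families *)

Lemma open_finite_forall (X : topologicalType) (T : eqType) (w : seq T)
    (F : T -> set X) :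
  (forall p, open (F p)) -> open [set x | forall p, p \in w -> F p x].
Proof.
move=> openF; elim: w => [|p w IHw].
  by rewrite (_ : [set x | _] = setT) ?eqEsubset//; exact: openT.
rewrite (_ : [set x | _] = F p `&` [set x | forall p, p \in w -> F p x]).
  exact: openI.
apply/seteqP; split=> x /=.
  by move=> Fx; split=> [|q qw]; apply: Fx; rewrite inE ?eqxx ?qw ?orbT.
by move=> [Fpx Fx] q; rewrite inE => /predU1P[->//|]; exact: Fx.
Qed.

Lemma open_guard (X : topologicalType) (P : Prop) (A : set X) :
  open A -> open [set x | P /\ A x].
Proof.
move=> openA; have [p|np] := pselect P.
  by rewrite (_ : [set x | _] = A)// eqEsubset; split=> x // [].
by rewrite (_ : [set x | _] = set0) ?eqEsubset; [exact: open0|split=> x // []].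
Qed.

(** Passing to indexed families also removes the convention that [X] is not a
    member of a cover: if some [U n j] is [X], choosing it is enough. *)
Lemma S1_indexed (X : topologicalType) (x0 : X) (J : countType)
    (U : nat -> J -> set X) :
  S1 (OO X) (OO X) -> (forall n j, open (U n j)) ->
  (forall n x, exists j, U n j x) ->
  exists f : nat -> J, forall x, exists n, U n (f n) x.
Proof.
move=> S1X openU covU.
have [[n [j Unj]]|proper] := pselect (exists n j, forall x, U n j x).
  have [f _] := choice (covU^~ x0).
  by exists (fun m => if m == n then j else f m) => x; exists n; rewrite eqxx.
have [n|V [UV [_ _ Vcov _]]] := S1X (fun n => range (U n)).
  split.
  - by apply: sub_countable (card_image_le _ _) _; exact: countableP.
  - by move=> _ [j _ <-].
  - apply/seteqP; split=> // x _; have [j Ux] := covU n x.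
    by exists (U n j) => //; exists j.
  - by case=> j _ Uj; apply: proper; exists n, j => x; rewrite Uj.
have [f fV] := choice (fun n => (fun '(ex_intro2 j _ e) => ex_intro _ j e) (UV n)
  : exists j, U n j = V n).
exists f => x; have : [set: X] x by [].
by rewrite -Vcov => -[_ [n _ <-] Vx]; exists n; rewrite fV.
Qed.

(** Apply the selection separately on infinitely many disjoint infinite sets of
    indices: each of them contributes an index for every point. *)
Lemma S1_indexed_often (X : topologicalType) (x0 : X) (J : countType)
    (U : nat -> J -> set X) :
  S1 (OO X) (OO X) -> (forall n j, open (U n j)) ->
  (forall n x, exists j, U n j x) ->
  exists f : nat -> J, forall x, infinite_set [set n | U n (f n) x].
Proof.
move=> S1X openU covU.
have [g gP] := choice (fun a : nat => S1_indexed
  (U := fun i : nat => U (pickle (a, i))) x0 S1X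
  (fun i j => openU (pickle (a, i)) j) (fun i => covU (pickle (a, i)))).
have [f0 _] := choice (covU^~ x0).
exists (fun n => if unpickle n is Some (a, i) then g a i else f0 n) => x.
have [h hP] := choice (gP^~ x).
apply: (@sub_infinite_set _ ((fun a => pickle (a, h a)) @` setT)).
  by move=> _ [a _ <-] /=; rewrite pickleK.
apply: infinite_image_in infinite_nat => a b _ _.
by move=> /(pcan_inj pickleK)[].
Qed.

(** Each [V n] covers only part of [X], but every point lies in infinitely many
    of these parts.  A partial selection at [n.+1] distinct indices, encoded as a
    list of (index, choice) pairs, is an element of a family [W n] that does
    cover [X].  Once one element of each [W n] has been selected, there is room
    to keep one pair from each, with pairwise distinct indices. *)
Lemma S1_partial_often (X : topologicalType) (x0 : X) (J : countType)
    (V : nat -> J -> set X) :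
  S1 (OO X) (OO X) -> (forall n j, open (V n j)) ->
  (forall x, infinite_set [set n | exists j, V n j x]) ->
  exists f : nat -> J, forall x, infinite_set [set n | V n (f n) x].
Proof.
move=> S1X openV infV.
have [_ [j0 _]] := infinite_setN0 (infV x0).
pose valid n (w : seq (nat * J)) := uniq (unzip1 w) /\ size w = n.+1.
pose W n w := [set x | valid n w /\ forall p, p \in w -> V p.1 p.2 x].
have openW n w : open (W n w) by apply/open_guard/open_finite_forall.
have covW n x : exists w, W n w x.
  have [B BV leB] := (infinite_set_fsetP _).1 (infV x) n.+1.
  have [g gP] : {g : nat -> J | forall j, (exists a, V j a x) -> V j (g j) x}.
    have /choice[g gP] : forall j, exists a, (exists b, V j b x) -> V j a x.
      move=> j; have [[a Va]|no] := pselect (exists b, V j b x).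
        by exists a.
      by exists j0.
    by exists g.
  (* The list [s] consists of [n.+1] indices whose parts contain [x]. *)
  set s := take n.+1 (finmap.enum_fset B).
  exists [seq (j, g j) | j <- s]; split; last first.
    move=> _ /mapP[j js ->] /=; apply/gP/BV.
    by move: js => /mem_take.
  rewrite /valid /unzip1 -map_comp map_id size_map size_takel//; split=> //.
  by rewrite take_uniq// finmap.fset_uniq.
have [w wP] := S1_indexed_often x0 S1X openW covW.
(* A list of [n.+1] distinct indices cannot be exhausted by the [n] indices kept
   so far; [js n] is the one kept from [w n]. *)
have [s|js jsP] := @seq_recursion nat (fun s j => valid (size s) (w (size s)) ->
    j \in unzip1 (w (size s)) /\ j \notin s).
  have [[uw sw]|nv] := pselect (valid (size s) (w (size s))); last by exists 0.
  suff /hasP[j jw js] : has (predC (mem s)) (unzip1 (w (size s))) by exists j.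
  apply/negPn; rewrite -all_predC; apply/negP => /allP sub.
  have := @uniq_leq_size _ _ s uw; rewrite size_map sw ltnn => /(_ _)/negP[]//.
  by move=> j /sub /=; rewrite negbK.
pose valid' n := valid n (w n).
have {}jsP n : valid' n -> js n \in unzip1 (w n) /\ forall m, m < n -> js m <> js n.
  have := jsP n; rewrite size_mkseq => /[apply] -[-> jn]; split=> // m mn e.
  by move: jn; rewrite -e => /negP; apply; apply: map_f; rewrite mem_iota.
have js_inj m n : valid' m -> valid' n -> js m = js n -> m = n.
  move=> /jsP[_ jm] /jsP[_ jn] e; case: (ltngtP m n) => // lt.
  - by case: (jn _ lt).
  - by case: (jm _ lt).
have /choice[f fP] : forall j, exists a,
    forall n, valid' n -> js n = j -> (j, a) \in w n.
  move=> j; have [[n [vn jn]]|no] := pselect (exists n, valid' n /\ js n = j).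
    have [/mapP[[i a] /= iw e] _] := jsP _ vn.
    exists a => m vm jm; rewrite -jn in jm *.
    by rewrite (js_inj _ _ vm vn jm) e.
  by exists j0 => n vn jn; case: no; exists n.
exists f => x; pose S := [set n | W n (w n) x].
apply: (@sub_infinite_set _ (js @` S)); last first.
  apply: infinite_image_in (wP x) => m n; rewrite !inE => -[vm _] [vn _].
  exact: js_inj.
by move=> _ [n [vn Wn] <-] /=; apply: (Wn (_, _)); exact: fP.
Qed.

(** * The Rothberger game *)

(** Write [g x m] for the least [k] with [B m k x], a nondecreasing function of
    [m].  If [f] is nondecreasing and [B (f n) (f n.+1) x] fails for all
    [n >= J], then [f] is dominated from [J] on by the iterates of [g x]
    started at [f J].  Hence it suffices that [f n] is infinitely often at least
    the [n]-th iterate of [g x] started at [n]; these iterates again define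
    countable open covers, to which the selection principle applies.  This
    replaces the Menger game.  The growth conditions given by [D] and [d] are
    free, as enlarging [f] is harmless. *)
Lemma S1_chain (X : topologicalType) (x0 : X) (B : nat -> nat -> set X)
    (D : nat -> nat) (d : nat) :
  S1 (OO X) (OO X) -> (forall m k, open (B m k)) ->
  (forall m m' k k', m' <= m -> k <= k' -> B m k `<=` B m' k') ->
  (forall m x, exists k, B m k x) ->
  exists f : nat -> nat, [/\ d < f 0, forall n, D (f n) < f n.+1 &
    forall x, infinite_set [set n | B (f n) (f n.+1) x]].
Proof.
move=> S1X openB monoB covB.
(* [It n m k] contains [x] when the [n]-th iterate of [g x] maps [m] to at most
   [k]. *)
pose fix It (n m k : nat) {struct n} : set X := if n is n'.+1
  then \bigcup_l (B m l `&` It n' l k) else [set x | m <= k].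
have openIt n m k : open (It n m k).
  elim: n m => [|n IHn] m /=; last by apply: bigcup_open => l _; exact: openI.
  rewrite (_ : [set x | _] = [set x | m <= k /\ setT x]).
    exact/open_guard/openT.
  by apply/seteqP; split=> x //= [].
have monoIt n m k k' : k <= k' -> It n m k `<=` It n m k'.
  move=> kk'; elim: n m => [|n IHn] m x /=; first by move=> /leq_trans; apply.
  by move=> [l _ [Bl /IHn Il]]; exists l.
have covIt n m x : exists k, It n m k x.
  elim: n m => [|n IHn] m /=; first by exists m.
  by have [l Bl] := covB m x; have [k Ik] := IHn l; exists k, l.
have [g gP] := S1_indexed_often x0 S1X (fun n k => openIt n n k)
  (fun n => covIt n n).
pose fix f n := if n is n'.+1 then g n + f n' + (D (f n')).+1 else g 0 + d.+1.
have le_f : {homo f : m n / m <= n}.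
  by apply: homo_leq => // [m n p|n]; [exact: leq_trans|rewrite /=; lia].
have le_gf n : g n <= f n by case: n => [|n] /=; lia.
exists f; split=> [|n|x]; [by rewrite /=; lia|by rewrite /=; lia|].
apply: contrapT => /contrapT/finite_seqP[s sP].
pose J := (\max_(i <- s) i).+1.
have noB n : J <= n -> ~ B (f n) (f n.+1) x.
  move=> Jn Bn; have : n \in s by have : [set` s] n by rewrite -sP.
  by move=> ns; have := @leq_bigmax_seq _ s xpredT id n ns isT; rewrite leqNgt Jn.
(* A chain of [p] steps that starts above [f j] stays above [f (j + p)]. *)
have escape p : forall j m k, J <= j -> f j < m -> It p m k x -> f (j + p) < k.
  elim: p => [|p IHp] j m k Jj fm /=.
    by rewrite addn0; exact: leq_trans.
  move=> [l _ [Bl Il]]; rewrite addnS -addSn; apply: IHp Il; first exact: leqW.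
  rewrite ltnNge; apply/negP => lf; apply: (noB j Jj).
  exact: (monoB m (f j) l (f j.+1) (ltnW fm) lf x Bl).
have [n nge Itn] := (infinite_natP _).1 (gP x) (f J).+1.
have := escape n J n (f n) (leqnn _) nge (monoIt _ _ _ _ (le_gf n) _ Itn).
by rewrite ltnNge le_f ?leq_addl.
Qed.

(** Pawlikowski's argument.  Nodes of the tree are coded by natural numbers.
    [B m k] is the set of points that, at every node with code below [m], are
    covered by a move below [k] leading to a node with code below [k].  By
    [S1_chain] there are bounds [M n] such that every point lies in
    [B (M n) (M n.+1)] for infinitely many [n].  For such [n], one finite table
    [phi], assigning a move to each node with code below [M n], suits the point;
    [S1_partial_often] selects one table per level so that every point is suited
    infinitely often, and the branch is obtained by following the tables. *)
Lemma S1_tree_branch (X : topologicalType) (x0 : X) (U : seq nat -> nat -> set X) :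
  S1 (OO X) (OO X) -> (forall s i, open (U s i)) ->
  (forall s x, exists i, U s i x) ->
  exists f : nat -> nat, forall x, infinite_set [set n | U (mkseq f n) (f n) x].
Proof.
move=> S1X openU covU.
pose dec := CodeSeq.decode; pose next c i := CodeSeq.code (rcons (dec c) i).
pose E k c := \bigcup_(i in [set i | i < k /\ next c i < k]) U (dec c) i.
pose B m k := [set x | forall c, c \in iota 0 m -> E k c x].
have monoE c k k' : k <= k' -> E k c `<=` E k' c.
  move=> kk' x [i [ik nk] Ui]; exists i => //.
  by split; exact: leq_trans kk'.
have /choice[D DP] m : exists k, forall c, c < m -> next c 0 < k.
  apply: (uniform_bound (P := fun c k => next c 0 < k) (finite_II m)) => c => [k k'|_].
    by move=> /[swap]; exact: leq_trans.
  by exists (next c 0).+1.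
have [|||M [M0 MD infM]] :=
  @S1_chain _ x0 B D (CodeSeq.code [::]) S1X.
- by move=> m k; apply: open_finite_forall => c; exact: bigcup_open.
- move=> m m' k k' mm' kk' x Bx c; rewrite mem_iota => /andP[_ cm'].
  by apply/(monoE _ _ _ kk')/Bx; rewrite mem_iota; apply: leq_trans mm'.
- move=> m x; have [c k k' kk'|c _|k kP] :=
      uniform_bound (P := fun c k => E k c x) (finite_II m).
  + exact: monoE.
  + have [i Ui] := covU (dec c) x; exists (i + next c i).+1, i => //=; lia.
  + by exists k => c; rewrite mem_iota; exact: kP.
pose V j (phi : seq nat) := [set x | forall c, c \in iota 0 (M j) ->
  next c (nth 0 phi c) < M j.+1 /\ U (dec c) (nth 0 phi c) x].
have [||Phi PhiP] := @S1_partial_often _ x0 _ V S1X.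
- by move=> j phi; apply: open_finite_forall => c; exact: open_guard.
- move=> x; apply: sub_infinite_set (infM x) => j /= Bj.
  have /choice[g gP] : forall c, exists i, c < M j ->
      next c i < M j.+1 /\ U (dec c) i x.
    move=> c; case: (ltnP c (M j)) => [lt|_]; last by exists 0.
    by have [|i []] := Bj c; [rewrite mem_iota|exists i].
  exists (mkseq g (M j)) => c; rewrite mem_iota => /andP[_ lt].
  by rewrite nth_mkseq//; exact: gP.
pose move s i := next (CodeSeq.code s) i < M (size s).+1.
pose answer s := nth 0 (Phi (size s)) (CodeSeq.code s).
(* The move [0] is played where the table would leave the bounds; [MD] ensures
   that [0] itself does not. *)
have [s|f fP] := @seq_recursion nat
    (fun s i => i = if move s (answer s) then answer s else 0).
  by eexists.
have codef n : CodeSeq.code (mkseq f n) < M n.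
  elim: n => [|n IHn]; first exact: M0.
  have := fP n; rewrite mkseqS /move size_mkseq.
  rewrite -[X in rcons X _]CodeSeq.codeK -/(next _ _); case: ifP => [+ -> //|_ ->].
  exact: leq_trans (DP _ _ IHn) (ltnW (MD n)).
exists f => x; apply: sub_infinite_set (PhiP x) => n /= /(_ (CodeSeq.code (mkseq f n))).
rewrite mem_iota => /(_ (codef n))[lt]; rewrite {1}/dec CodeSeq.codeK.
by have := fP n; rewrite /move /answer size_mkseq lt => <-.
Qed.

Lemma legal_position_rcons T (sigma : seq T -> set T) s v :
  legal_position sigma s -> sigma s v -> legal_position sigma (rcons s v).
Proof.
move=> legal_s sv s1 w s2; case: (lastP s2) => [|s3 z].
  by rewrite cats1 => /rcons_inj[<- <-].
by rewrite -rcons_cons -rcons_cat => /rcons_inj[/legal_s].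
Qed.

Lemma large_cover_setD (X : topologicalType) (U : set (set X)) (s : seq (set X))
    (x : X) :
  large_cover U -> exists2 V, (U `\` [set` s]) V & V x.
Proof.
move=> [_ /(_ x) infU].
have [V [[UV Vx] sV]] := infinite_setN0 (infinite_setD infU (finite_seq s)).
by exists V.
Qed.

(** TWO only considers sets not played before.  Removing finitely many sets from
    a large cover leaves a cover, so the possible plays form a tree of covers,
    and along the branch of [S1_tree_branch] the answers are pairwise distinct
    and cover each point infinitely often. *)
Lemma S1_no_winning_strategy (X : topologicalType) (x0 : X) :
  S1 (OO X) (OO X) -> ~ ONE_has_winning_strategy_G1 (Lambda X) (Lambda X).
Proof.
move=> S1X [sigma [moves win]].
have /choice[e eP] : forall s, exists e : nat -> set X,
    legal_position sigma s -> range e = sigma s `\` [set` s].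
  move=> s; have [ls|nls] := pselect (legal_position sigma s); last first.
    by exists (fun=> set0); move=> /nls.
  have [||e eE] := @countable_enum _ (sigma s `\` [set` s]); last by exists e.
    by apply: sub_countable (card_le_setD _ _) _; have [[]] := moves _ ls.
  by have [V sV _] := large_cover_setD s x0 (moves _ ls); exists V.
pose pos t := foldl (fun s i => rcons s (e s i)) [::] t.
pose U t i := [set x | legal_position sigma (pos t) -> e (pos t) i x].
have openU t i : open (U t i).
  have [lt|nlt] := pselect (legal_position sigma (pos t)); last first.
    by rewrite (_ : U t i = setT) ?eqEsubset; [exact: openT|split=> x // _ /nlt].
  rewrite (_ : U t i = e (pos t) i); last first.
    by apply/seteqP; split=> x /=; [move=> /(_ lt)|move=> ? _].
  have [[_ + _ _] _] := moves _ lt; apply.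
  have [] // : (sigma (pos t) `\` [set` pos t]) (e (pos t) i).
  by rewrite -eP//; exists i.
have covU t x : exists i, U t i x.
  have [lt|nlt] := pselect (legal_position sigma (pos t)); last first.
    by exists 0; rewrite /U /= => /nlt.
  have [V + Vx] := large_cover_setD (pos t) x (moves _ lt).
  by rewrite -eP// => -[i _ eV]; exists i; rewrite /U /= eV.
have [f fP] := S1_tree_branch x0 S1X openU covU.
pose V n := e (pos (mkseq f n)) (f n).
have posV n : pos (mkseq f n) = mkseq V n.
  by elim: n => // n IHn; rewrite !mkseqS /pos foldl_rcons -/(pos _) {1}IHn.
have freshV n : legal_position sigma (mkseq V n) ->
    (sigma (mkseq V n) `\` [set` mkseq V n]) (V n).
  by move=> ln; rewrite -eP// /V posV; exists (f n).
have legalV n : legal_position sigma (mkseq V n).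
  elim: n => [|n IHn]; first by case.
  by rewrite mkseqS; apply: legal_position_rcons => //; have [] := freshV n IHn.
have V_inj : injective V.
  have neV m n : m < n -> V m <> V n.
    move=> mn e'; have [_] := freshV n (legalV n); apply.
    by rewrite /= -e'; apply: map_f; rewrite mem_iota.
  by move=> m n e'; case: (ltngtP m n) => // /neV; rewrite e'.
have coverV n : is_cover (sigma (mkseq V n)) by have [] := moves _ (legalV n).
have sigmaV n : sigma (mkseq V n) (V n) by have [] := freshV n (legalV n).
have infV x : infinite_set [set n | V n x].
  apply: sub_infinite_set (fP x) => n /=.
  by rewrite /U /V /= posV; apply; exact: legalV.
apply: (win V) => //; split; first split.
- by apply: sub_countable (card_image_le _ _) _; exact: countableP.
- by move=> _ [n _ <-]; have [_ + _ _] := coverV n; apply.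
- apply/seteqP; split=> // x _; have [n Vx] := infinite_setN0 (infV x).
  by exists (V n) => //; exists n.
- by move=> [n _ Vn]; have [_ _ _] := coverV n; rewrite -Vn; apply.
move=> x; apply: (@sub_infinite_set _ (V @` [set n | V n x])).
  by move=> _ [n Vx <-]; split=> //; exists n.
by apply: infinite_image_in (infV x) => m n _ _; exact: V_inj.
Qed.

(** * Linear refinements of sequences of sets *)

(** Refinements are indexed by the points of [X] and not, as in
    [linearly_refinable], by the sets of indices; and the sequence need not be
    injective.  Both make the notion stable under reindexing and enlarging. *)
Definition taustar_sequence (X : Type) (W : nat -> set X) :=
  exists h : X -> set nat,
    (forall x, infinite_set (h x) /\ h x `<=` [set n | W n x]) /\
    forall x y, almost_subset (h x) (h y) \/ almost_subset (h y) (h x).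

Lemma finite_nat_bound (A : set nat) : finite_set A -> exists K, forall n, A n -> n < K.
Proof.
move=> /finite_seqP[s ->]; exists (\max_(i <- s) i).+1 => n /= ns.
by rewrite ltnS; exact: (@leq_bigmax_seq _ s xpredT id).
Qed.

Lemma injective_diverges (phi : nat -> nat) :
  injective phi -> forall K, exists M, forall n, M <= n -> K <= phi n.
Proof.
move=> phi_inj K; have [|M MP] := @finite_nat_bound (phi @^-1` `I_K).
  by apply: finite_preimage => // m n _ _; exact: phi_inj.
by exists M => n; apply: contra_leq => /MP.
Qed.

(** Images of the refinements under [phi] stay infinite because [phi] is
    finite-to-one, and images preserve almost inclusion. *)
Lemma taustar_sequence_map (X : Type) (W W' : nat -> set X) (phi : nat -> nat) N :
  (forall K, exists M, forall n, M <= n -> K <= phi n) ->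
  (forall n, N <= n -> W n `<=` W' (phi n)) ->
  taustar_sequence W -> taustar_sequence W'.
Proof.
move=> phi_oo subW [h [hW lin]].
exists (fun x => phi @` (h x `\` `I_N)); split=> [x|x y].
  have [infh hWx] := hW x; split.
    apply/infinite_natP => K; have [M MP] := phi_oo K.
    have [n nge hn] := (infinite_natP _).1 infh (maxn M N).
    exists (phi n); first by apply/MP/(leq_trans _ nge)/leq_maxl.
    exists n => //; split=> //=; apply/negP; rewrite -leqNgt.
    by apply: leq_trans nge; exact: leq_maxr.
  move=> _ [n [hn /negP Nn] <-]; rewrite -leqNgt in Nn.
  by apply: (subW n Nn); exact: hWx.
have sub a b : almost_subset (h a) (h b) ->
    almost_subset (phi @` (h a `\` `I_N)) (phi @` (h b `\` `I_N)).
  move=> /(finite_image phi); apply: sub_finite_set => _ [[n [han Nn] <-] nb].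
  by exists n => //; split=> // hbn; apply: nb; exists n.
by case: (lin x y) => /sub; [left|right].
Qed.

(** If the refinement of some point [z] meets [D] in a finite set only, then the
    refinement of every other point, being comparable with that of [z], is
    infinite outside [D]. *)
Lemma taustar_sequence_split (X : Type) (W : nat -> set X) (D : set nat) :
  taustar_sequence W ->
  taustar_sequence (fun n => [set x | D n /\ W n x]) \/
  taustar_sequence (fun n => [set x | ~ D n /\ W n x]).
Proof.
move=> [h [hW lin]].
have [infD|] := pselect (forall x, infinite_set (h x `&` D)).
  left; exists (fun x => h x `&` D); split=> [x|x y].
    by split=> // n [hn Dn]; split=> //; have [_] := hW x; exact.
  have sub a b : almost_subset (h a) (h b) ->
      almost_subset (h a `&` D) (h b `&` D).
    by apply: sub_finite_set => n [[han Dn] nb]; split=> // hb; apply: nb.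
  by case: (lin x y) => /sub; [left|right].
move=> /existsNP[z /contrapT finD]; right.
exists (fun x => h x `\` D); split=> [x|x y]; last first.
  have sub a b : almost_subset (h a) (h b) ->
      almost_subset (h a `\` D) (h b `\` D).
    by apply: sub_finite_set => n [[han Dn] nb]; split=> // hb; apply: nb.
  by case: (lin x y) => /sub; [left|right].
split; last by move=> n [hn Dn]; split=> //; have [_] := hW x; exact.
case: (lin x z) => sub.
  have [infx _] := hW x.
  have finU : finite_set ((h x `\` h z) `|` (h z `&` D)) by rewrite finite_setU.
  apply: sub_infinite_set (infinite_setD infx finU) => n [hx nU]; split=> // Dn.
  by apply: nU; have [hz|nhz] := pselect (h z n); [right|left].
have [infz _] := hW z.
have finU : finite_set ((h z `\` h x) `|` (h z `&` D)) by rewrite finite_setU.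
apply: sub_infinite_set (infinite_setD infz finU) => n [hz nU]; split.
  by apply: contrapT => nhx; apply: nU; left.
by move=> Dn; apply: nU; right.
Qed.

Lemma taustar_cover_enum (X : topologicalType) (U : set (set X)) :
  taustar_cover U -> exists2 e, set_bij [set: nat] U e & taustar_sequence e.
Proof.
move=> [_ [e [bije _ [h [hP lin]]]]]; exists e => //.
exists (fun x => h [set n | e n x]); split=> [x|x y]; first by apply: hP; exists x.
by apply: lin; eexists; try reflexivity; eexists.
Qed.

(** The members of the range are enumerated injectively by the definition of
    a cover in [Tstar X]; choosing for each of them one index at which [W] takes
    this value is an injective reindexing. *)
Lemma taustar_cover_range (X : topologicalType) (W : nat -> set X) :
  taustar_cover (range W) -> taustar_sequence W.
Proof.
move=> /taustar_cover_enum[e [eW e_inj _] tau_e].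
have /choice[k kP] : forall j, exists n, W n = e j.
  by move=> j; have [n _ <-] := eW j I; exists n.
apply: (@taustar_sequence_map _ e W k 0) tau_e => [|j _]; last by rewrite kP.
apply: injective_diverges => i j kij; apply: e_inj; rewrite ?inE//.
by rewrite -!kP kij.
Qed.

Lemma taustar_sequence_cover (X : topologicalType) (x0 : X) (W : nat -> set X) :
  injective W -> (forall n, open (W n)) -> (forall n, W n <> setT) ->
  taustar_sequence W -> taustar_cover (range W).
Proof.
move=> W_inj openW WT [h [hW lin]]; split; first split.
- by apply: sub_countable (card_image_le _ _) _; exact: countableP.
- by move=> _ [n _ <-].
- apply/seteqP; split=> // x _; have [infh hWx] := hW x.
  by have [n /hWx Wx] := infinite_setN0 infh; exists (W n) => //; exists n.
- by move=> [n _ /WT].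
exists W; split.
- by split=> [n _|m n _ _ /W_inj//|_ [n _ <-]]; exists n.
- by move=> x; have [infh hWx] := hW x; exact: sub_infinite_set infh.
have /choice[r rP] : forall y, exists x,
    range (fun x => [set n | W n x]) y -> [set n | W n x] = y.
  move=> y; have [[x _ <-]|no] := pselect (range (fun x => [set n | W n x]) y).
    by exists x.
  by exists x0 => /no.
exists (h \o r); split=> [y /rP Wy|_ _ [a _ <-] [b _ <-]]; last exact: lin.
by rewrite /= -{3}Wy; exact: hW.
Qed.

(** * Large covers glue to tau-star covers *)

Lemma homo_increasing (c : nat -> nat) :
  (forall i, c i < c i.+1) -> {homo c : i j / i <= j}.
Proof.
by move=> inc; apply: homo_leq => // [i j k|i]; [exact: leq_trans|exact: ltnW].
Qed.

Lemma increasing_index (c : nat -> nat) :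
  (forall i, c i < c i.+1) ->
  forall n, c 0 <= n -> exists i, c i <= n < c i.+1.
Proof.
move=> inc n c0; have id_le i : i <= c i.
  by elim: i => // i IHi; exact: leq_ltn_trans (inc i).
case: (@ex_maxnP (fun i => c i <= n) n) => [|i /(leq_trans (id_le i))//|i ci maxi].
  by exists 0.
exists i; rewrite ci ltnNge; apply/negP => /maxi; by rewrite ltnn.
Qed.

Lemma increasing_index_inj (c : nat -> nat) i j n :
  (forall i, c i < c i.+1) -> c i <= n < c i.+1 -> c j <= n < c j.+1 -> i = j.
Proof.
move=> /homo_increasing inc /andP[ci ci1] /andP[cj cj1].
case: (ltngtP i j) => // /inc.
- by move=> /(leq_trans ci1)/leq_trans/(_ cj); rewrite ltnn.
- by move=> /(leq_trans cj1)/leq_trans/(_ ci); rewrite ltnn.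
Qed.

Lemma interval_partition T (U : set T) (u : nat -> T) (c : nat -> nat) :
  set_bij [set: nat] U u -> c 0 = 0 -> (forall i, c i < c i.+1) ->
  let I i := u @` [set n | c i <= n < c i.+1] in
  [/\ partition (range I) id U, injective I & forall i, finite_set (I i)].
Proof.
move=> [uU u_inj Usurj] c0 inc I.
have I_meet i j : I i `&` I j !=set0 -> i = j.
  move=> [_ [[n ni <-] [n' nj e]]].
  have nn' : n' = n by apply: u_inj => //; rewrite inE.
  by move: nj; rewrite /= nn'; exact: increasing_index_inj.
have I0 i : I i !=set0 by exists (u (c i)), (c i); rewrite //= leqnn inc.
split=> [|i j Iij|i]; first split.
- apply/seteqP; split=> [_ [_ [i _ <-] [n _ <-]]|v /Usurj[n _ <-]]; first exact: uU.
  have [|i ni] := increasing_index inc (n := n); first by rewrite c0.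
  by exists (I i); [exists i|exists n].
- by move=> _ _ [i _ <-] [j _ <-] /I_meet ->.
- by move=> _ [i _ <-].
- by apply: I_meet; rewrite -Iij setIid.
- by apply/finite_image/(sub_finite_set _ (finite_II (c i.+1))) => n /= /andP[].
Qed.

Lemma large_cover_enum (X : topologicalType) (x0 : X) (U : set (set X)) :
  large_cover U -> exists2 u, set_bij [set: nat] U u &
    forall x, infinite_set [set n : nat | u n x].
Proof.
move=> [[countU _ _ _] largeU].
have infU : infinite_set U by apply: sub_infinite_set (largeU x0) => V [].
have [u [uU u_inj Usurj]] : exists u, set_bij [set: nat] U u.
  exact/card_set_bijP/card_esym/eq_card_nat.
exists u => // x fin; apply: (largeU x).
apply: sub_finite_set (finite_image u fin) => V [/Usurj[n _ <-] ux].
by exists n.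
Qed.

(** Enumerate the cover as [u] and let [T a b] be the union of the sets [u n]
    with [a <= n < b].  If every tail of [u] has a finite subcover, cutting [u]
    into finite subcovers shows that the cover is multifinite.  Otherwise the
    tails from some [m] on have no finite subcover, and the selection principle
    gives finite unions [W k] of elements beyond [k] that form a tau-star
    sequence.  Take a fast increasing sequence [c], so that [W k] is contained
    in the union of the interval of [c] containing [k] and of the next one.
    These pairs of adjacent intervals overlap; but by [taustar_sequence_split],
    one may keep only the [k] in intervals of a fixed parity, and then the pairs
    form a partition. *)
Lemma Lambda_sub_gimel (X : topologicalType) (x0 : X) :
  Ufin (OO X) (Tstar X) -> Lambda X `<=` gimel (Tstar X).
Proof.
move=> ufin U largeU; have [[_ openU covU UT] _] := largeU.
have [u biju inf_u] := large_cover_enum x0 largeU.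
have [uU u_inj Usurj] := biju.
split; first by case: largeU.
pose T a b := \bigcup_(n in [set n | a <= n < b]) u n.
have subT a a' b b' : a' <= a -> b <= b' -> T a b `<=` T a' b'.
  move=> aa bb x [n /andP[an nb] ux]; exists n => //=.
  by rewrite (leq_trans aa an) (leq_trans nb bb).
have block_union a b : \bigcup_(V in u @` [set n | a <= n < b]) V = T a b.
  by rewrite bigcup_image.
have [allm|/existsNP[m /forallNP noT]] := pselect (forall m, exists k, T m k = setT).
  left; have [g gP] := choice allm.
  pose c i := iter i (fun m => maxn (g m) m.+1) 0.
  have inc i : c i < c i.+1 by rewrite /= leq_max leqnn orbT.
  have [partI I_inj finI] := interval_partition biju (erefl : c 0 = 0) inc.
  eexists; split; first exact: partI.
    by apply: infinite_image_in infinite_nat => i j _ _; exact: I_inj.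
  move=> _ [i _ <-]; split=> //; split.
  - exact: finite_set_countable.
  - by move=> _ [n _ <-]; apply/openU/uU.
  - rewrite block_union; apply/seteqP; split=> // x _.
    by apply: (subT (c i) (c i) (g (c i))); rewrite ?gP//= leq_max leqnn.
  - by move=> [n _ un]; apply: UT; rewrite -un; exact: uU.
right.
pose tail k := u @` [set n | maxn m k <= n].
have finite_tail k F : F `<=` tail k -> finite_set F ->
    exists b, \bigcup_(V in F) V `<=` T (maxn m k) b.
  move=> Fk finF.
  have [|b bP] := @finite_nat_bound (u @^-1` F).
    by apply: finite_preimage => // i j _ _ /u_inj; rewrite !inE; exact.
  exists b => x [V FV Vx]; have [n mn uV] := Fk V FV.
  by exists n; rewrite ?uV//=; apply/andP; split=> //; apply: bP; rewrite /= uV.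
have [k|k [F [Fk finF [_ _ covF _]]]|F [FP tauF]] := ufin tail.
- split.
  + by apply: sub_countable (card_image_le _ _) _; exact: countableP.
  + by move=> _ [n _ <-]; apply/openU/uU.
  + apply/seteqP; split=> // x _.
    have [n kn ux] := (infinite_natP _).1 (inf_u x) (maxn m k).
    by exists (u n) => //; exists n.
  + by move=> [n _ un]; apply: UT; rewrite -un; exact: uU.
- have [b] := finite_tail k F Fk finF; rewrite covF => subTb.
  apply: (noT b); apply/seteqP; split=> // x xT; apply: subT (subTb x xT) => //.
  exact: leq_maxl.
have /choice[g gP] k : exists b, \bigcup_(V in F k) V `<=` T (maxn m k) b.
  by have [finF Fk] := FP k; exact: finite_tail.
have {}tauF := taustar_cover_range tauF; set W := (W in taustar_sequence W) in tauF.
(* The third condition on [next] makes the unions of the later blocks pairwise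
   distinct: each interval of [c] covers a point missed by all intervals before
   it. *)
have /choice[next nextP] a : exists b, [/\ a < b, forall k, k < a -> g k <= b &
    ~ (T a b `<=` T m a)].
  have [z /not_implyP[_ zT]] : exists z, ~ (setT z -> T m a z).
    by apply/existsNP => sub; apply: (noT a); apply/seteqP; split=> // x /sub.
  have [n an uz] := (infinite_natP _).1 (inf_u z) a.
  have [k b b' bb' /leq_trans|k _|b bP] :=
    uniform_bound (P := fun k b => g k <= b) (finite_II a).
  - exact.
  - by exists (g k).
  exists (maxn b n.+1); split.
  - by rewrite leq_max orbC ltnS an.
  - by move=> k /bP gk; rewrite leq_max gk.
  - move=> sub; apply/zT/sub; exists n => //=.
    by rewrite an leq_max orbC leqnn.
pose c i := iter i next m.
have inc i : c i < c i.+1 by case: (nextP (c i)).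
have c_homo := homo_increasing inc.
have /choice[beta betaP] k : exists i, m <= k -> c i <= k < c i.+1.
  have [mk|_] := leqP m k; last by exists 0.
  by have [i ki] := increasing_index inc mk; exists i.
have beta_oo K : exists M, forall n, M <= n -> K <= beta n.
  exists (c K) => n cn; have mn : m <= n by apply: leq_trans cn; exact: (c_homo 0).
  have /andP[_] := betaP n mn; move/(leq_ltn_trans cn).
  by apply: contraTT; rewrite -leqNgt -ltnNge => /c_homo.
have W_sub k : m <= k -> W k `<=` T (c (beta k)) (c (beta k).+2).
  move=> mk; have /andP[ck kc] := betaP k mk; apply: subset_trans (gP k) _.
  apply: subT; first by rewrite (maxn_idPr mk).
  by have [_ + _] := nextP (c (beta k).+1); apply.
pose start p i := if i is j.+1 then c (i.*2 + p) else 0.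
have start_le p i : start p i <= c (i.*2 + p) by case: i.
have [p tauY] : exists p,
    taustar_sequence (fun i => T (start p i) (start p i.+1)).
  have half_oo K : exists N, forall n, N <= n -> K <= (beta n)./2.
    have [N NP] := beta_oo K.*2; exists N => n /NP /half_leq.
    by rewrite doubleK.
  have sub_half p n : m <= n -> odd (beta n) = p :> nat ->
      W n `<=` T (start p (beta n)./2) (start p (beta n)./2.+1).
    move=> mn oddn x /(W_sub n mn); have := odd_double_half (beta n).
    rewrite oddn addnC => betan; apply: subT; last first.
      by rewrite /start doubleS !addSn betan.
    by apply: leq_trans (start_le _ _) _; rewrite betan.
  have [] := taustar_sequence_split (fun n => odd (beta n)) tauF => tau.
  - exists 1; apply: (taustar_sequence_map (N := m) half_oo _ tau) => n mn x /= [oddn].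
    by apply: (sub_half 1 n mn); rewrite oddn.
  - exists 0; apply: (taustar_sequence_map (N := m) half_oo _ tau) => n mn x.
    move=> /= [/negP oddn].
    by apply: (sub_half 0 n mn); rewrite (negbTE oddn).
set Y := (Y in taustar_sequence Y) in tauY.
have m_start i : m <= start p i.+1 by exact: (c_homo 0).
have inc_start i : start p i < start p i.+1.
  by apply: leq_ltn_trans (start_le _ _) _; apply: leq_trans (inc _) (ltnW (inc _)).
have start_homo := homo_increasing inc_start.
have YT i : Y i.+1 <> setT.
  move=> YiT; apply: (noT (start p i.+2)); apply/seteqP; split=> // x.
  by rewrite -YiT; exact: subT.
have Y_inj i j : i < j -> Y i.+1 <> Y j.+1.
  move=> ij eY; have [_ _] := nextP (start p j.+1); apply=> x Tx.
  have : Y j.+1 x by apply: subT Tx => //; exact: ltnW (inc _).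
  by rewrite -eY; apply: subT => //; exact: start_homo.
have openY i : open (Y i) by apply: bigcup_open => n _; exact/openU/uU.
have tauY1 : taustar_sequence (fun i => Y i.+1).
  apply: (@taustar_sequence_map _ Y _ predn 1) tauY => [K|[//|n] _ x].
    by exists K.+1 => -[].
  exact.
have [partI _ finI] := interval_partition biju (erefl : start p 0 = 0) inc_start.
eexists; split; [exact: partI|by move=> _ [i _ <-]|].
rewrite (_ : [set _ | _ in _] = range Y); last first.
  by rewrite image_comp; apply: eq_imagel => i _; exact: block_union.
(* The initial block, which contains the elements below [m], is the only one
   whose union may be [X] or repeat that of another block; if so, it contributes
   nothing to the set of unions. *)
have [redundant|new] := pselect (Y 0 = setT \/ exists i, Y 0 = Y i.+1).
  rewrite (_ : _ `\` _ = range (fun i => Y i.+1)).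
    apply: taustar_sequence_cover tauY1 => // i j eY.
    by case: (ltngtP i j) => // /Y_inj; rewrite eY.
  apply/seteqP; split=> [V [[[|i] _ <-] /= VT]|_ [i _ <-]].
  - by case: redundant => // -[i ->]; exists i.
  - by exists i.
  - by split=> [|/YT]//; exists i.+1.
move/not_orP: new => [Y0T /forallNP Y0].
have Y_T i : Y i <> setT by case: i.
rewrite (_ : _ `\` _ = range Y).
  apply: taustar_sequence_cover tauY => // -[|i] [|j]// eY.
  - by case: (Y0 j).
  - by case: (Y0 i).
  - by case: (ltngtP i j) => [/Y_inj|/Y_inj|->//]; rewrite eY.
by apply/seteqP; split=> [V []|_ [i _ <-]]//; split=> [|/Y_T]//; exists i.
Qed.

(** * Games and selection principles *)

Lemma ONE_winning_strategy_G1_mono T (A A' B B' : set (set T)) :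
  A `<=` A' -> B `<=` B' ->
  ONE_has_winning_strategy_G1 A B' -> ONE_has_winning_strategy_G1 A' B.
Proof.
move=> AA' BB' [sigma [moves win]]; exists sigma.
by split=> [s /moves/AA'|V /win + /BB'].
Qed.

Lemma S1_of_game T (A B : set (set T)) :
  ~ ONE_has_winning_strategy_G1 A B -> S1 A B.
Proof.
move=> noWin U AU; apply: contrapT => noS; apply: noWin.
exists (fun s => U (size s)); split=> [s _ //|V UV BV].
by apply: noS; exists V; split=> // n; have := UV n; rewrite size_mkseq.
Qed.

Lemma Omega_sub_Lambda (X : topologicalType) : Omega X `<=` Lambda X.
Proof.
move=> U [coverU omegaU]; split=> // x /finite_seqP[s sE].
have [_ _ _ UT] := coverU.
have /choice[y yP] (V : set X) : exists y, V <> setT -> ~ V y.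
  have [->|VT] := pselect (V = setT); first by exists x.
  have /existsNP[y Vy] : ~ forall y, V y.
    by move=> allV; apply: VT; apply/seteqP; split=> // z _.
  by exists y.
have [|V UV subV] := omegaU (x |` y @` [set` s]).
  by rewrite finite_setU; split=> //; exact: finite_image.
have Vs : [set` s] V by rewrite -sE; split=> //; apply: subV; left.
have /yP : V <> setT by move=> VT; apply: UT; rewrite -VT.
by apply; apply: subV; right; exists V.
Qed.

(** * Partition relations *)

Lemma nsubsets2E T (a s : set T) :
  nsubsets 2 a s <-> exists x y, [/\ a x, a y, x <> y & s = [set x; y]].
Proof.
split=> [[sa /eq_cardSP[x sx /eq_cardSP[y [sy yx]]]]|[x [y [ax ay xy ->]]]].
  rewrite II0 card_eq0 => /eqP s0; exists x, y; split; [exact: sa|exact: sa| |].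
    by move=> xy; apply: yx.
  apply/seteqP; split=> [z sz|z [->|->]//].
  have [->|zx] := pselect (z = x); first by left.
  have [->|zy] := pselect (z = y); first by right.
  by have : set0 z by rewrite -s0.
split; first by move=> _ [->|->].
apply/eq_cardSP; exists x; first by left.
apply/eq_cardSP; exists y; first by split; [right|move=> yx; apply: xy].
rewrite II0 card_eq0; apply/eqP/seteqP; split=> // z [[[->|->] nx] ny].
- exact: nx.
- exact: ny.
Qed.

(** The sets of members of [a] containing a given finite set generate a proper
    filter; members of an ultrafilter extending it meet all of these sets. *)
Lemma ultrafilter_of_omega_covers (X : topologicalType) (a : set (set X)) :
  omega_cover a -> exists D : set_system (set X), UltraFilter D /\
    forall B, D B -> omega_cover (a `&` B).
Proof.
move=> [[counta opena cova aT] omegaa].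
pose F0 : set_system (set X) := [set B | exists2 S, finite_set S &
  forall V, a V -> S `<=` V -> B V].
have properF0 : ProperFilter F0.
  apply: Build_ProperFilter_ex => [B [S finS SB]|].
    by have [V aV SV] := omegaa S finS; exists V; exact: SB.
  split=> [|B C [S finS SB] [S' finS' SC]|B C BC [S finS SB]].
  - by exists set0.
  - exists (S `|` S'); first by rewrite finite_setU.
    by move=> V aV; rewrite subUset => -[SV S'V]; split; [exact: SB|exact: SC].
  - by exists S => // V aV SV; exact/BC/SB.
have [D [ultraD F0D]] := ultraFilterLemma properF0.
exists D; split=> // B DB.
have omegaB S : finite_set S -> exists2 V, (a `&` B) V & S `<=` V.
  move=> finS; have DS : D [set V | a V /\ S `<=` V] by apply: F0D; exists S.
  by have [V [BV [aV SV]]] := filter_ex (filterI DB DS); exists V.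
split=> //; split.
- by apply: sub_countable counta; apply: subset_card_le => V [].
- by move=> V [/opena].
- apply/seteqP; split=> // x _; have [V aBV xV] := omegaB _ (finite_set1 x).
  by exists V => //; exact: xV.
- by case=> /aT.
Qed.

(** With respect to an ultrafilter [D] of omega covers, each [V] has a colour
    [g V] which it forms with almost all [W], and [g] itself has a constant value
    [c] almost everywhere.  ONE plays the sets of colour [c] that form pairs of
    colour [c] with all earlier answers; this is a member of [D] as long as the
    answers have colour [c], so a play won by TWO is homogeneous. *)
Lemma game_partition_relation (X : topologicalType) (B : set (set (set X))) k :
  ~ ONE_has_winning_strategy_G1 (Omega X) B -> partition_relation (Omega X) B 2 k.
Proof.
move=> noWin a omegaa f; apply: contrapT => nob; apply: noWin.
have [D [ultraD Domega]] := ultrafilter_of_omega_covers omegaa.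
have colour (c : set X -> 'I_k) : exists i, D [set V | c V = i].
  apply: contrapT => /forallNP noi.
  have [|V /(_ (c V))//] := @filter_ex _ D _ (fun V => forall i, c V <> i).
  apply: filter_forall => i.
  by have [/noi|] := in_ultra_setVsetC [set V | c V = i] ultraD.
have /choice[g gP] V := colour (fun W => f [set V; W]).
have [c cP] := colour g.
pose A (s : seq (set X)) := [set W | g W = c /\ forall v, v \in s -> f [set v; W] = c].
have DA s : (forall v, v \in s -> g v = c) -> D (A s).
  elim: s => [|v s IHs] gs; first by apply: filterS cP => W.
  have /IHs As : forall w, w \in s -> g w = c.
    by move=> w ws; apply: gs; rewrite inE ws orbT.
  have := gP v; rewrite (gs v (mem_head _ _)) => Dv.
  apply: filterS (filterI As Dv) => W [[gW fW] fvW]; split=> // w.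
  by rewrite inE => /predU1P[->|/fW].
exists (fun s => a `&` A s); split=> [s legals|V moveV BV].
  apply/Domega/DA => v vs; case/path.splitPr: vs legals => s1 s2 legals.
  by have [_ [-> _]] := legals s1 v s2 erefl.
apply: nob; exists (range V); split=> //.
  by move=> _ [n _ <-]; have [] := moveV n.
have homog i j : i < j -> f [set V i; V j] = c.
  move=> ij; have [_ [_]] := moveV j; apply.
  by apply: map_f; rewrite mem_iota.
exists c => s /nsubsets2E[_ [_ [[i _ <-] [j _ <-] ij ->]]].
case: (ltngtP i j) => [/homog//|/homog|eij]; first by rewrite setUC.
by case: ij; rewrite eij.
Qed.

(** * Selections from omega covers *)

(** The common weakening of [S1 (Omega X) B] and of the partition relation:
    only some of the covers are used, at most once each, and the selected
    elements may be shrunk. *)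
Definition omega_selection (X : topologicalType) (B : set (set (set X))) :=
  forall U : nat -> set (set X), (forall n, Omega X (U n)) ->
    exists b (iota : set X -> nat), [/\ B b,
      forall V W, b V -> b W -> iota V = iota W -> V = W &
      forall V, b V -> exists2 W, U (iota V) W & V `<=` W].

Lemma S1_omega_selection (X : topologicalType) (B : set (set (set X))) :
  S1 (Omega X) B -> omega_selection B.
Proof.
move=> S1B U omegaU; have [V [UV BV]] := S1B U omegaU.
have /choice[iota iotaP] (W : set X) : exists n, range V W -> V n = W.
  by have [[n _ VW]|no] := pselect (range V W); [exists n|exists 0 => /no].
exists (range V), iota; split=> // [W W' /iotaP + /iotaP + e|W /iotaP VW].
  by rewrite e => -> ->.
by exists W => //; rewrite -{2}VW.
Qed.

(** Enumerate [U 0] as [e], and colour pairs of sets of the form [e n `&` W],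
    with [W] in [U n], according to whether both sets have the same index [n].
    A homogeneous set with constant index lies inside a single [e n], so it
    covers [X] only if the indices of its elements are all distinct. *)
Lemma partition_omega_selection (X : topologicalType) (x0 : X)
    (B : set (set (set X))) :
  B `<=` OO X -> partition_relation (Omega X) B 2 2 -> omega_selection B.
Proof.
move=> subB part U omegaU.
have [[countU0 openU0 _ U0T] omegaU0] := omegaU 0.
have [|e eU0] := countable_enum countU0.
  by have [V U0V _] := omegaU0 _ (finite_set0 X); exists V.
pose a := \bigcup_n [set e n `&` W | W in U n].
have a_e V : a V -> exists n, V `<=` e n /\ exists2 W, U n W & V `<=` W.
  by move=> [n _ [W UW <-]]; exists n; split=> [x []//|]; exists W => // x [].
have omega_a : omega_cover a.
  have omega F : finite_set F -> exists2 V, a V & F `<=` V.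
    move=> finF; have [V + FV] := omegaU0 F finF; rewrite -eU0 => -[n _ en].
    have [_ /(_ F finF)[W UW FW]] := omegaU n.
    exists (e n `&` W); first by exists n => //; exists W.
    by rewrite en => x Fx; split; [exact: FV|exact: FW].
  split=> //; split.
  - apply: bigcup_countable => // n _; apply: sub_countable (card_image_le _ _) _.
    by have [[]] := omegaU n.
  - move=> _ [n _ [W UW <-]]; apply: openI.
      by apply: openU0; rewrite -eU0; exists n.
    by have [[_ + _ _] _] := omegaU n; apply.
  - apply/seteqP; split=> // x _; have [V aV xV] := omega _ (finite_set1 x).
    by exists V => //; exact: xV.
  - move=> /a_e[n [eT _]]; apply: U0T; rewrite -eU0; exists n => //.
    by apply/seteqP; split.
have /choice[iota iotaP] (V : set X) : exists n,
    a V -> V `<=` e n /\ exists2 W, U n W & V `<=` W.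
  have [/a_e[n en]|na] := pselect (a V); last by exists 0 => /na.
  by exists n.
pose f (s : set (set X)) : 'I_2 :=
  if `[< forall V W, s V -> s W -> iota V = iota W >] then ord0 else ord_max.
have [b [ba Bb [c homog]]] := part a omega_a f.
have [_ openb covb bT] := subB b Bb.
have [V0 bV0 V0x] : (\bigcup_(V in b) V) x0 by rewrite covb.
have [mono|/existsNP[V /existsNP[W /not_implyP[bV /not_implyP[bW VW]]]]] :=
    pselect (forall V W, b V -> b W -> iota V = iota W).
  case: U0T; rewrite -eU0; exists (iota V0) => //.
  apply/seteqP; split=> // x _; have [V bV Vx] : (\bigcup_(V in b) V) x by rewrite covb.
  have [/(_ x Vx) + _] := iotaP V (ba V bV).
  by rewrite (mono V V0).
have fVW : f [set V; W] = c.
  apply/homog/nsubsets2E; exists V, W; split=> //.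
  by move=> eVW; apply: VW; rewrite eVW.
have c1 : c = ord_max.
  rewrite -fVW /f; case: asboolP => // /(_ V W (or_introl erefl) (or_intror erefl)).
  by move=> /VW.
exists b, iota; split=> // [V' W' bV' bW' eiota|V' bV']; last first.
  by have [] := iotaP V' (ba V' bV').
apply: contrapT => neq; have : f [set V'; W'] = c.
  by apply/homog/nsubsets2E; exists V', W'.
rewrite c1 /f asboolT// => v w [->|->] [->|->] //.
Qed.

Lemma cover_enum (X : topologicalType) (x0 : X) (U : nat -> set (set X)) :
  (forall n, is_cover (U n)) -> exists E : nat -> nat -> set X,
    [/\ forall n, range (E n) = U n, forall n i, open (E n i) &
    forall n x, exists i, E n i x].
Proof.
move=> coverU; have /choice[E EU] n : exists e : nat -> set X, range e = U n.
  have [countU _ covU _] := coverU n; apply: countable_enum => //.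
  have : [set: X] x0 by [].
  by rewrite -covU => -[V UV _]; exists V.
exists E; split=> // [n i|n x]; have [_ openU covU _] := coverU n.
  by apply: openU; rewrite -EU; exists i.
have : [set: X] x by [].
by rewrite -covU -EU => -[_ [i _ <-] Ex]; exists i.
Qed.

(** The covers are arranged in infinitely many infinite blocks.  Unions of one
    element from each of finitely many initial covers of block [j] form an omega
    cover, as a block offers a cover for each point of a finite set.  The
    selected set of index [j] is contained in one such union. *)
Lemma omega_selection_S1 (X : topologicalType) (x0 : X) (B : set (set (set X))) :
  B `<=` OO X -> omega_selection B -> S1 (OO X) (OO X).
Proof.
move=> subB selB U coverU; have [E [EU openE covE]] := cover_enum x0 coverU.
pose fin (j : nat) (t : seq nat) :=
  \bigcup_(i in `I_(size t)) E (pickle (j, i)) (nth 0 t i).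
suff [t tP] : exists t : nat -> seq nat, forall x, exists j, fin j (t j) x.
  pose V n := E n (if unpickle n is Some (j, i) then nth 0 (t j) i else 0).
  have UV n : U n (V n) by rewrite -EU; eexists.
  exists V; split=> //; split.
  - by apply: sub_countable (card_image_le _ _) _; exact: countableP.
  - by move=> _ [n _ <-]; exact: openE.
  - apply/seteqP; split=> // x _; have [j [i _ Ex]] := tP x.
    exists (V (pickle (j, i))); first by eexists.
    by rewrite /V pickleK.
  - by move=> [n _ Vn]; have [_ _ _] := coverU n; rewrite -Vn.
have [[j [t finT]]|proper] := pselect (exists j t, fin j t = setT).
  by exists (fun=> t) => x; exists j; rewrite finT.
have omega_fin j : omega_cover (range (fin j)).
  have omega F : finite_set F -> exists2 V, range (fin j) V & F `<=` V.
    move=> /finite_seqP[s ->].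
    have /choice[k kP] i := covE (pickle (j, i)) (nth x0 s i).
    exists (fin j (mkseq k (size s))) => [|x /= xs]; first by eexists.
    have lt : index x s < size s by rewrite index_mem.
    exists (index x s); rewrite /= ?size_mkseq// nth_mkseq//.
    by have := kP (index x s); rewrite nth_index.
  split=> //; split.
  - by apply: sub_countable (card_image_le _ _) _; exact: countableP.
  - by move=> _ [t _ <-]; apply: bigcup_open => i _; exact: openE.
  - apply/seteqP; split=> // x _; have [V jV xV] := omega _ (finite_set1 x).
    by exists V => //; exact: xV.
  - by move=> [t _ tT]; apply: proper; exists j, t.
have [b [iota [Bb iota_inj bP]]] := selB _ omega_fin.
have /choice[t tP] j : exists t, forall V, b V -> iota V = j -> V `<=` fin j t.
  have [[V [bV Vj]]|no] := pselect (exists V, b V /\ iota V = j); last first.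
    by exists [::] => V bV Vj; case: no; exists V.
  have [_ [t _ <-] Vt] := bP V bV; exists t => W bW Wj.
  by rewrite (iota_inj W V bW bV) ?Wj// -Vj.
exists t => x; have [_ _ covb _] := subB b Bb.
have : [set: X] x by [].
by rewrite -covb => -[V bV Vx]; exists (iota V); exact: tP Vx.
Qed.

(** Let [S n k] be the union of the first [k] elements of [U n].  The sets
    [Z n k], the intersections of the [S i k] for [i <= n], form an omega cover
    for each [n].  The selected elements with index at least [m] are contained in
    sets [S m k], hence so is any finite union of them.  A finite block [F] of
    the selected family is therefore absorbed by a set [S m k] where [m] is the
    least index of an element of [F]; distinct blocks have distinct least
    indices. *)
Lemma omega_selection_Ufin (X : topologicalType) (x0 : X) :
  omega_selection (gimel (Tstar X)) -> Ufin (OO X) (Tstar X).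
Proof.
move=> selG U coverU noFin; have [E [EU openE covE]] := cover_enum x0 coverU.
pose part n k := E n @` `I_k.
pose S n k := \bigcup_(V in part n k) V.
have partU n k : part n k `<=` U n by move=> _ [i _ <-]; rewrite -EU; exists i.
have fin_part n k : finite_set (part n k) by exact: finite_image.
have openS n k : open (S n k) by apply: bigcup_open => _ [i _ <-].
have S_mono n k k' : k <= k' -> S n k `<=` S n k'.
  move=> kk' x [_ [i ik <-] Ex]; exists (E n i) => //; exists i => //=.
  exact: leq_trans kk'.
have covS n x : exists k, S n k x.
  by have [i Ex] := covE n x; exists i.+1, (E n i) => //; exists i => /=.
have ST n k : S n k <> setT.
  move=> SnT; apply: (noFin n); exists (part n k); split=> //.
  have [_ openU _ UT] := coverU n; split=> //.
  - exact: finite_set_countable.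
  - by move=> V /partU /openU.
  - by move=> /partU.
pose Z n k := [set x | forall i, i \in iota 0 n.+1 -> S i k x].
have Z_mono n k k' : k <= k' -> Z n k `<=` Z n k'.
  by move=> kk' x Zx i /Zx; exact: S_mono.
have Z_sub n i k : i <= n -> Z n k `<=` S i k.
  by move=> iN x; apply; rewrite mem_iota.
have omegaZ n : omega_cover (range (Z n)).
  have omega F : finite_set F -> exists2 V, range (Z n) V & F `<=` V.
    move=> finF; have [x k k' kk'|x _|k FZ] :=
      uniform_bound (P := fun x k => Z n k x) finF; last by exists (Z n k); [exists k|].
      exact: Z_mono.
    have [i k k' kk'|i _|k kP] :=
      uniform_bound (P := fun i k => S i k x) (finite_seq (iota 0 n.+1)).
    - exact: S_mono.
    - exact: covS.
    - by exists k.
  split=> //; split.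
  - by apply: sub_countable (card_image_le _ _) _; exact: countableP.
  - by move=> _ [k _ <-]; exact: open_finite_forall.
  - apply/seteqP; split=> // x _; have [V nV xV] := omega _ (finite_set1 x).
    by exists V => //; exact: xV.
  - move=> [k _ ZT]; apply: (ST 0 k); apply/seteqP; split=> // x.
    by rewrite -ZT; exact: Z_sub.
have [b [iota [[coverb gimelb] iota_inj bP]]] := selG _ omegaZ.
have block_sub F m : F `<=` b -> finite_set F -> (forall V, F V -> m <= iota V) ->
    exists k, \bigcup_(V in F) V `<=` S m k.
  move=> Fb finF Fm; have [V k k' kk'|V FV|k kP] :=
    uniform_bound (P := fun V k => V `<=` S m k) finF.
  - by move=> /subset_trans; apply; exact: S_mono.
  - have [_ [k _ <-] VZ] := bP V (Fb V FV); exists k.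
    by apply: subset_trans VZ _; exact/Z_sub/Fm.
  - by exists k => x [V FV Vx]; exact: kP Vx.
(* A finite subcover of the selected family would be absorbed by a proper set
   [S 0 k], so the family is not multifinite. *)
case: gimelb => [[P [[covP _ _] infP finP]]|[P [[covP trivP P0] finP tauP]]].
  have [F PF] := infinite_setN0 infP; have [finF [_ _ covF _]] := finP F PF.
  have [||k] := block_sub F 0 _ finF; [|by []|].
    by move=> V FV; rewrite -covP; exists F.
  by rewrite covF => subS; case: (ST 0 k); apply/seteqP; split.
have Pb F : P F -> F `<=` b by move=> PF V FV; rewrite -covP; exists F.
have [e [e_mem e_inj _] tau_e] := taustar_cover_enum tauP.
have /choice[F FP] j : exists F, P F /\ \bigcup_(V in F) V = e j.
  by have [[F PF Fe] _] := e_mem j I; exists F.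
have /choice[v vP] j : exists V, F j V /\ forall W, F j W -> iota V <= iota W.
  have [PF _] := FP j; have [V FV] := P0 _ PF.
  have : exists n, `[< exists V, F j V /\ iota V = n >].
    by exists (iota V); apply/asboolP; exists V.
  move=> /ex_minnP[_ /asboolP[W [FW <-]] minW]; exists W; split=> // W' FW'.
  by apply: minW; apply/asboolP; exists W'.
pose lead j := iota (v j).
have lead_inj : injective lead.
  move=> i j eij; have [[PFi Fi] [PFj Fj]] := (FP i, FP j).
  have [[Fvi _] [Fvj _]] := (vP i, vP j).
  have vij : v i = v j.
    by apply: iota_inj eij; [exact: Pb Fvi|exact: Pb Fvj].
  apply: e_inj; rewrite ?inE// -Fi -Fj; congr (\bigcup_(V in _) V).
  by apply: trivP => //; exists (v i); split=> //; rewrite vij.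
have /choice[K KP] n : exists k, forall j, lead j = n -> e j `<=` S n k.
  have [[j <-]|no] := pselect (exists j, lead j = n); last first.
    by exists 0 => j jn; case: no; exists j.
  have [PF Fe] := FP j; have [|||k] := block_sub (F j) (lead j).
  - exact: Pb.
  - exact: finP.
  - by have [_] := vP j.
  - by rewrite Fe => ek; exists k => i /lead_inj ->.
(* The bounds are enlarged so that each union covers a point missed by each
   earlier one, which makes the unions pairwise distinct. *)
have [s|kappa kappaP] := @seq_recursion nat (fun s k => K (size s) <= k /\
    forall i, i < size s -> ~ (S (size s) k `<=` S i (nth 0 s i))).
  have [i k k' kk' nsub sub|i _|k kP] := uniform_bound
    (P := fun i k => ~ (S (size s) k `<=` S i (nth 0 s i))) (finite_II (size s)).
  - by apply: nsub; apply: subset_trans sub; exact: S_mono.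
  - have /existsNP[x xS] : ~ forall x, S i (nth 0 s i) x.
      by move=> allS; apply: (ST i (nth 0 s i)); apply/seteqP; split=> // x _.
    by have [k Sx] := covS (size s) x; exists k => sub; apply/xS/sub.
  exists (maxn (K (size s)) k); split=> [|i /kP nsub sub]; first exact: leq_maxl.
  by apply: nsub; apply: subset_trans sub; apply: S_mono; exact: leq_maxr.
have leK n : K n <= kappa n by have [] := kappaP n; rewrite size_mkseq.
have fresh i n : i < n -> S i (kappa i) <> S n (kappa n).
  move=> lt; have [_] := kappaP n; rewrite size_mkseq => /(_ i lt).
  by rewrite nth_mkseq// => nsub e'; apply: nsub; rewrite e'.
exists (fun n => part n (kappa n)); split=> //.
apply: (@taustar_sequence_cover _ x0 (fun n => S n (kappa n))) => // [i j eij|].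
  by case: (ltngtP i j) => // /fresh; rewrite eij.
apply: (taustar_sequence_map (N := 0) (injective_diverges lead_inj) _ tau_e) => j _.
by apply: subset_trans (KP _ j erefl) _; exact: S_mono.
Qed.

(** * The equivalences *)

Theorem theorem25 (X : topologicalType) (X_nonempty : [set: X] !=set0) :
  [<-> S1 (OO X) (OO X) /\ Ufin (OO X) (Tstar X);
       S1 (Lambda X) (gimel (Tstar X));
       S1 (Omega X) (gimel (Tstar X));
       ~ ONE_has_winning_strategy_G1 (Omega X) (gimel (Tstar X));
       partition_relation (Omega X) (gimel (Tstar X)) 2 2;
       forall k : nat, (0 < k)%N ->
         partition_relation (Omega X) (gimel (Tstar X)) 2 k].
Proof.
have [x0 _] := X_nonempty.
have gimel_cover : gimel (Tstar X) `<=` OO X by move=> U [].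
have selection_1 : omega_selection (gimel (Tstar X)) ->
    S1 (OO X) (OO X) /\ Ufin (OO X) (Tstar X).
  move=> sel; split; first exact: omega_selection_S1 gimel_cover sel.
  exact: omega_selection_Ufin.
have Lambda_game : S1 (OO X) (OO X) /\ Ufin (OO X) (Tstar X) ->
    ~ ONE_has_winning_strategy_G1 (Lambda X) (gimel (Tstar X)).
  move=> [S1X ufin] win; apply: (S1_no_winning_strategy x0 S1X).
  exact: ONE_winning_strategy_G1_mono (Lambda_sub_gimel x0 ufin) win.
have Omega_game : S1 (OO X) (OO X) /\ Ufin (OO X) (Tstar X) ->
    ~ ONE_has_winning_strategy_G1 (Omega X) (gimel (Tstar X)).
  move=> /Lambda_game noWin win; apply: noWin.
  exact: ONE_winning_strategy_G1_mono (@Omega_sub_Lambda X) _ win.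
have part_1 : partition_relation (Omega X) (gimel (Tstar X)) 2 2 ->
    S1 (OO X) (OO X) /\ Ufin (OO X) (Tstar X).
  by move=> part; apply/selection_1/(partition_omega_selection x0).
tfae.
- by move=> /Lambda_game/S1_of_game.
- by move=> S1L U omegaU; apply: S1L => n; exact: Omega_sub_Lambda.
- by move=> S1O; apply/Omega_game/selection_1/S1_omega_selection.
- exact: game_partition_relation.
- by move=> /part_1/Omega_game noWin k _; exact: game_partition_relation.
- by move=> part; apply/part_1/part.
Qed.
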